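(* For every integer $\ell\geq4$, $$\alpha_{\mathbb N}(\ell)=\beta_{\mathbb N}(\ell)=\alpha_{\mathbb Z}(\ell)=\beta_{\mathbb Z}(\ell)=1.$$
   Context: $\mathbb N=\{1,2,\ldots\}$. An $\omega$-permutation of a countably infinite set $S$ of integers is a sequence $p_0,p_1,\ldots$ of elements of $S$ in which every element of $S$ occurs exactly once. It contains a monotone arithmetic progression of length $\ell$ if there are indices $i_0<i_1<\cdots<i_{\ell-1}$, $x\in\mathbb Z$ and $d\in\mathbb Z\setminus\{0\}$ such that $p_{i_j}=x+jd$ for all $0\leq j<\ell$. The set $S$ is $\ell$-permutable if it has an $\omega$-permutation containing no monotone arithmetic progression of length $\ell$. For $S\subseteq\mathbb N$, $\overline d_{\mathbb N}(S)$ and $\underline d_{\mathbb N}(S)$ are the $\limsup$ and $\liminf$, respectively, of $|S\cap[1,n]|/n$ as $n\to\infty$. For $T\subseteq\mathbb Z$, $\overline d_{\mathbb Z}(T)$ and $\underline d_{\mathbb Z}(T)$ are the $\limsup$ and $\liminf$, respectively, of $|T\cap[-n,n]|/(2n+1)$ as $n\to\infty$. For $X\in\{\mathbb N,\mathbb Z\}$, $$\alpha_X(\ell)=\sup\{\overline d_X(S):S\subseteq X\text{ is infinite and }\ell\text{-permutable}\},$$ $$\beta_X(\ell)=\sup\{\underline d_X(S):S\subseteq X\text{ is infinite and }\ell\text{-permutable}\}.$$ *)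

(* Defs.v *)
From HB Require Import structures.
From mathcomp Require Import all_boot all_order all_algebra.
From mathcomp Require Import finmap.
From mathcomp Require Import all_classical all_reals all_analysis.

Set Implicit Arguments.
Unset Strict Implicit.
Unset Printing Implicit Defensive.

Import Order.TTheory GRing.Theory Num.Theory.

Local Open Scope classical_set_scope.
Local Open Scope ring_scope.

Definition omega_permutation (S : set int) (p : nat -> int) : Prop :=
  set_bij [set: nat] S p.

(* [x] and [d] are integers, so decreasing progressions are included. *)
Definition has_monotone_ap (p : nat -> int) (l : nat) : Prop :=
  exists (i : 'I_l -> nat) (x d : int),
    [/\ {homo i : j k / (j < k)%N}, d != 0 &
        forall j : 'I_l, p (i j) = x + (j : nat)%:Z * d].

Definition permutable (l : nat) (S : set int) : Prop :=
  exists p : nat -> int, omega_permutation S p /\ ~ has_monotone_ap p l.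

Definition posint : set int := [set x | 0 < x].

(* |S `&` [a, b]|; the intersection is finite, so [fset_set] is not junk. *)
Definition count_in (S : set int) (a b : int) : nat :=
  #|` fset_set (S `&` `[a, b]) |.

(* The term of index 0 is 0 / 0 = 0, which does not affect limits. *)
Definition ratioN (R : realType) (S : set int) : R^nat :=
  fun n => (count_in S 1 n%:Z)%:R / n%:R.

Definition ratioZ (R : realType) (S : set int) : R^nat :=
  fun n => (count_in S (- n%:Z) n%:Z)%:R / (2 * n + 1)%N%:R.

Definition upper_densityN (R : realType) (S : set int) : R :=
  limn_sup (ratioN R S).
Definition lower_densityN (R : realType) (S : set int) : R :=
  limn_inf (ratioN R S).
Definition upper_densityZ (R : realType) (S : set int) : R :=
  limn_sup (ratioZ R S).
Definition lower_densityZ (R : realType) (S : set int) : R :=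
  limn_inf (ratioZ R S).

Definition permutable_subsets (X : set int) (l : nat) : set (set int) :=
  [set S | [/\ S `<=` X, infinite_set S & permutable l S]].

(* All densities lie in [0, 1], so the real-valued [sup] is the genuine
   supremum as soon as [permutable_subsets] is nonempty; otherwise it is 0. *)
Definition alphaN (R : realType) (l : nat) : R :=
  sup (upper_densityN R @` permutable_subsets posint l).
Definition betaN (R : realType) (l : nat) : R :=
  sup (lower_densityN R @` permutable_subsets posint l).
Definition alphaZ (R : realType) (l : nat) : R :=
  sup (upper_densityZ R @` permutable_subsets [set: int] l).
Definition betaZ (R : realType) (l : nat) : R :=
  sup (lower_densityZ R @` permutable_subsets [set: int] l).

(* Main.v *)
Require Import Defs.
From mathcomp Require Import all_boot all_order all_algebra.
From mathcomp Require Import finmap.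
From mathcomp Require Import all_classical all_reals all_analysis.
From mathcomp Require Import zify.

Set Implicit Arguments.
Unset Strict Implicit.
Unset Printing Implicit Defensive.

Import Order.TTheory GRing.Theory Num.Theory.

Local Open Scope classical_set_scope.
Local Open Scope ring_scope.

(** Order integers by the reversal of their binary digits: along an arithmetic
    progression the comparison of neighbours alternates, so no three terms are
    monotone. Place the integers in stages of growing magnitude, positive and
    negative numbers in alternate stages, each stage being ordered by bit
    reversal, with opposite orientations for the two signs. The magnitude at
    which a residue class modulo [m = 2 ^ M] passes from one stage to the next
    one of its sign depends on the class: thresholds are powers of 4, distinct
    for distinct classes, and a class placed earlier within a stage has the
    larger threshold. While a class passes, its numbers in a whole factor 4 are
    dropped; at every scale at most one class per sign is being dropped, so the
    density is at least [1 - O(1 / m)].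

    If [y] is placed before [z], of the same sign and with [|z| <= 4 |y|], then
    [y] precedes [z] in the bit-reversal order even across a passage. Hence three
    consecutive same-sign terms whose sizes grow at most fourfold are never
    monotone. The other four-term progressions either have three terms in one
    stage, or two terms of each sign, and these are excluded by the opposite
    orientations. *)

(** * Binary digit reversal *)

Fixpoint bitrev (L : nat) (y : int) : nat :=
  if L is L'.+1 then (`|(y %% 2)%Z| * 2 ^ L' + bitrev L' (y %/ 2)%Z)%N else 0%N.

Lemma bitrev_lt L y : (bitrev L y < 2 ^ L)%N.
Proof.
elim: L y => //= L IH y; have := IH (y %/ 2)%Z; rewrite expnS.
have : (`|(y %% 2)%Z| <= 1)%N by lia.
by case: `|_|%N => [|[|]] //; lia.
Qed.

Lemma bitrevC L y : (bitrev L (- 1 - y) + bitrev L y = 2 ^ L - 1)%N.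
Proof.
elim: L y => //= L IH y.
have -> : ((- 1 - y) %/ 2)%Z = - 1 - (y %/ 2)%Z by lia.
have := IH (y %/ 2)%Z; rewrite expnS.
have -> : `|((- 1 - y) %% 2)%Z|%N = (1 - `|(y %% 2)%Z|)%N by lia.
have : (`|(y %% 2)%Z| <= 1)%N by lia.
have : (0 < 2 ^ L)%N by rewrite expn_gt0.
move: (bitrev L _) (bitrev L _) (2 ^ L)%N `|_|%N => a b p [|[|]] //=; lia.
Qed.

(** An even [d] keeps the leading digit constant and passes the question to the halves. An odd [d]
    gives the two outer terms one leading digit and the middle term the other. *)
Lemma bitrev_ap L a d :
  ((bitrev L a < bitrev L (a + d)) = (bitrev L (a + d + d) < bitrev L (a + d)))%N *
  ((bitrev L (a + d) < bitrev L a) = (bitrev L (a + d) < bitrev L (a + d + d)))%N.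
Proof.
elim: L a d => //= L IH a d.
have [d0|d1] : (d %% 2)%Z = 0 \/ (d %% 2)%Z = 1 by lia.
  have -> : ((a + d) %/ 2)%Z = (a %/ 2)%Z + (d %/ 2)%Z by lia.
  have -> : ((a + d + d) %/ 2)%Z = (a %/ 2)%Z + (d %/ 2)%Z + (d %/ 2)%Z by lia.
  have -> : ((a + d) %% 2)%Z = (a %% 2)%Z by lia.
  have -> : ((a + d + d) %% 2)%Z = (a %% 2)%Z by lia.
  by rewrite !ltn_add2l; apply: IH.
have -> : ((a + d + d) %% 2)%Z = (a %% 2)%Z by lia.
have -> : `|((a + d) %% 2)%Z|%N = (1 - `|(a %% 2)%Z|)%N by lia.
have : (`|(a %% 2)%Z| <= 1)%N by lia.
have := bitrev_lt L (a %/ 2)%Z; have := bitrev_lt L ((a + d) %/ 2)%Z.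
have := bitrev_lt L ((a + d + d) %/ 2)%Z.
move: (bitrev L _) (bitrev L _) (bitrev L _) (2 ^ L)%N `|_|%N => x y z p.
by move=> [|[|b]] ? ? ? ?; split; lia.
Qed.

(** Reading more bits only appends less significant digits, so a strict comparison at length [L]
    persists at every larger length. *)
Lemma bitrev_prefix L K y : (bitrev (L + K) y %/ 2 ^ K = bitrev L y)%N.
Proof.
elim: L y => [|L IH] y /=; first by rewrite divn_small // bitrev_lt.
by rewrite expnD mulnA divnMDl ?expn_gt0 // IH.
Qed.

Lemma bitrev_eqmod L y z : bitrev L y = bitrev L z ->
  exists q : int, y - z = q * (2 ^ L)%N%:Z.
Proof.
elim: L y z => [|L IH] y z /=; first by move=> _; exists (y - z); lia.
have := bitrev_lt L (y %/ 2)%Z; have := bitrev_lt L (z %/ 2)%Z.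
have : (`|(y %% 2)%Z| <= 1)%N by lia.
have : (`|(z %% 2)%Z| <= 1)%N by lia.
move=> by1 bz1 ly lz e.
have digits : forall p u v a b : nat, (a < p)%N -> (b < p)%N -> (v <= 1)%N ->
    (u <= 1)%N -> (v * p + b = u * p + a)%N -> u = v /\ a = b.
  by move=> p [|[|u]] [|[|v]]; lia.
have [||b /esym/IH[q qE]] := digits _ _ _ _ _ ly lz _ _ e; [lia|lia|].
by exists q; rewrite expnS; nia.
Qed.

(** * The bit-reversal order on signed integers *)

(* [- 1 - y] is the two's complement bitwise negation of [y]. *)
Definition fold0 (y : int) : int := if y < 0 then - 1 - y else y.
Definition bitcode (L : nat) (y : int) : nat := bitrev L (fold0 y).
Definition expo (y : int) : nat := trunc_log 4 `|y|%N.

Lemma bitcode_lt L y : (bitcode L y < 2 ^ L)%N.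
Proof. exact: bitrev_lt. Qed.

Lemma bitcode_neg L y : y < 0 -> (bitcode L y + bitrev L y = 2 ^ L - 1)%N.
Proof. by rewrite /bitcode /fold0 => ->; apply: bitrevC. Qed.

Lemma bitcode_pos L y : (y < 0) = false -> bitcode L y = bitrev L y.
Proof. by rewrite /bitcode /fold0 => ->. Qed.

Lemma bitcode_mono L L' y z :
  (L <= L')%N -> (bitcode L z < bitcode L y)%N -> (bitcode L' z < bitcode L' y)%N.
Proof.
move=> /subnKC <-; apply: contraTT; rewrite -!leqNgt.
by move=> /(leq_div2r (2 ^ (L' - L))); rewrite !bitrev_prefix.
Qed.

(* By [bitcode_mono], a witness [L] can be replaced by any larger one. *)
Definition precedes (y z : int) : Prop := exists L, (bitcode L z < bitcode L y)%N.

Lemma precedes_asym y z : precedes y z -> ~ precedes z y.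
Proof.
move=> [L hL] [K hK].
have := bitcode_mono (leq_maxl L K) hL; have := bitcode_mono (leq_maxr L K) hK.
by lia.
Qed.

Lemma precedes_ap (a b c : int) : b - a = c - b -> (a < 0) = (b < 0) ->
  (b < 0) = (c < 0) -> precedes a b -> ~ precedes b c.
Proof.
move=> abc ab bc [L hL]; apply: precedes_asym; exists L.
move: hL; rewrite /bitcode /fold0 -bc ab; case: ifP => _.
  (* Folding negative terms turns the common difference [b - a] into [a - b]. *)
  have -> : - 1 - b = (- 1 - a) + (a - b) by lia.
  have -> : - 1 - c = (- 1 - a) + (a - b) + (a - b) by lia.
  by rewrite (bitrev_ap L _ _).2.
have -> : b = a + (b - a) by lia.
have -> : c = a + (b - a) + (b - a) by lia.
by rewrite (bitrev_ap L _ _).2.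
Qed.

(* Complementing the bits of the negative terms reverses the order, whereas the
   alternation along a progression makes the two pairs compare alike. *)
Lemma precedes_crossing (a b c d : int) : b - a = c - b -> c - b = d - c ->
  (a < 0) = (b < 0) -> (b < 0) = ~~ (c < 0) -> (c < 0) = (d < 0) ->
  precedes a b -> ~ precedes c d.
Proof.
move=> abc bcd ab bc cd [L hL]; apply: precedes_asym; exists L.
have bE : b = a + (b - a) by lia.
have cE : c = a + (b - a) + (b - a) by lia.
have dE : d = b + (b - a) + (b - a) by lia.
have cE' : c = b + (b - a) by lia.
have [e1 e2] := bitrev_ap L a (b - a); rewrite -cE -bE in e1 e2.
have [e3 e4] := bitrev_ap L b (b - a); rewrite -dE -cE' in e3 e4.
have := bitrev_lt L a; have := bitrev_lt L b.
have := bitrev_lt L c; have := bitrev_lt L d.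
move: hL; case: (ltP c 0) bc cd => [c0|c0] b0 d0.
  rewrite (bitcode_pos L b0) (bitcode_pos L (etrans ab b0)) => hL ? ? ? ?.
  have := bitcode_neg L c0; have := bitcode_neg L (esym d0).
  by move: e3; rewrite -e2 hL => /esym; lia.
have {}c0 : (c < 0) = false by lia.
rewrite (bitcode_pos L (esym d0)) (bitcode_pos L c0) -e4 -e1.
by have := bitcode_neg L b0; have := bitcode_neg L (etrans ab b0); lia.
Qed.

Lemma expo_le4 (y z : int) : y != 0 -> (`|z| <= 4 * `|y|)%N -> (expo z <= (expo y).+1)%N.
Proof.
move=> y0 yz; rewrite /expo -trunc_logMp ?absz_gt0 //.
exact: leq_trunc_log.
Qed.

(** * Stages and keys *)

Section Stages.
Variable M : nat.
Let m := (2 ^ M)%N.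

(* With [m = 2 ^ M], stage [s] holds numbers of the sign given by the parity of
   [s], and a class leaves it at the exponent [s * m + bitcode]. Numbers whose
   exponent equals such a threshold are dropped; [stage] is the least [s] of the
   right parity whose threshold exceeds the exponent (see [stage_bounds]). *)
Definition slot (y : int) : nat := (expo y + 2 * m - ((y < 0)%R * m + bitcode M y))%N.
Definition kept : set int := [set y : int | (y != 0) && ~~ (2 * m %| slot y)%N]%classic.
Definition stage (y : int) : nat := (2 * (slot y %/ (2 * m)) + (y < 0)%R)%N.
Definition width (s : nat) : nat := (2 * (s.+1 * m))%N.
(* Orders by stage first, then by decreasing [bitcode]. *)
Definition key (y : int) : nat :=
  let W := width (stage y) in (2 ^ W + (2 ^ W - 1 - bitcode W y))%N.

Let m_gt0 : (0 < m)%N. Proof. by rewrite expn_gt0. Qed.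

Lemma stage_parity y : odd (stage y) = (y < 0).
Proof. by rewrite /stage oddD mul2n odd_double; case: (y < 0). Qed.

Lemma stage_bounds y : kept y ->
  (expo y < stage y * m + bitcode M y < expo y + 2 * m)%N.
Proof.
rewrite /kept /stage /= => /andP[y0].
have := bitcode_lt M y; rewrite -/m => lt; rewrite /dvdn => hm.
have := divn_eq (slot y) (2 * m); have := ltn_pmod (slot y) (_ : 0 < 2 * m)%N.
have -> : (0 < 2 * m)%N by lia.
move=> /(_ isT); move: hm; rewrite -lt0n.
move: (slot y %% _)%N (slot y %/ _)%N (erefl (slot y)) => r q.
rewrite {1}/slot; case: (y < 0) => /=; nia.
Qed.

Lemma key_cases y z : (key y < key z)%N ->
  (stage y < stage z)%N \/ stage y = stage z /\ precedes y z.
Proof.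
have [zy|yz|e] := ltngtP (stage y) (stage z); [by left| |].
  rewrite /key /= => h; exfalso; move: h; apply/negP; rewrite -leqNgt.
  have := bitcode_lt (width (stage y)) y; have := bitcode_lt (width (stage z)) z.
  have : (2 ^ (width (stage z)).+1 <= 2 ^ width (stage y))%N.
    by rewrite leq_exp2l // /width; nia.
  by rewrite expnS; lia.
rewrite /key /= e => h; right; split=> //; exists (width (stage z)).
have := bitcode_lt (width (stage z)) y; have := bitcode_lt (width (stage z)) z.
by lia.
Qed.

Lemma kept_width y : kept y -> (`|y| < 2 ^ width (stage y))%N.
Proof.
move=> ky; have /andP[h _] := stage_bounds ky.
have /andP[y0 _] : (y != 0) && ~~ (2 * m %| slot y)%N by [].
have /andP[_ h'] : (4 ^ expo y <= `|y| < 4 ^ (expo y).+1)%N.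
  by apply: trunc_log_bounds => //; rewrite absz_gt0.
apply: leq_trans h' _; rewrite /width expnM leq_exp2l //.
by have := bitcode_lt M y; rewrite -/m; lia.
Qed.

(** Keys of one stage lie in [[2 ^ W, 2 ^ W.+1)] with [W] its width, and these blocks are disjoint,
    so the key fixes the stage and hence the sign. By [kept_width] the number is then determined by
    its class modulo [2 ^ W]. *)
Lemma key_inj y z : kept y -> kept z -> key y = key z -> y = z.
Proof.
move=> ky kz e.
have es : stage y = stage z.
  apply/eqP; rewrite eqn_leq; apply/andP.
  have cy := bitcode_lt (width (stage y)) y; have cz := bitcode_lt (width (stage z)) z.
  have H s s' : (s < s')%N -> (2 ^ (width s).+1 <= 2 ^ width s')%N.
    by move=> ss'; rewrite leq_exp2l // /width; nia.
  move: e; rewrite /key /= => e.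
  by split; rewrite leqNgt; apply/negP => /H; rewrite expnS; lia.
have s : (y < 0) = (z < 0) by rewrite -!stage_parity es.
have hy := kept_width ky; have hz := kept_width kz.
move: e hy; rewrite /key /= es; set W := width (stage z) in hz *.
have := bitcode_lt W y; have := bitcode_lt W z => cz cy e hy.
have {}e : bitcode W y = bitcode W z by lia.
have [q hq] := bitrev_eqmod e.
have fy : 0 <= fold0 y < (2 ^ W)%N%:Z by rewrite /fold0; case: ifP; lia.
have fz : 0 <= fold0 z < (2 ^ W)%N%:Z by rewrite /fold0; case: ifP; lia.
have q0 : q = 0 by nia.
by move: hq; rewrite q0 mul0r /fold0 -s; case: ifP; lia.
Qed.

(* Each passage of a class from one stage to the next one of the same sign skips
   a whole factor 4, so a class still in the older stage at magnitude [`|y|] has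
   the larger threshold, i.e. the larger bitcode. *)
Lemma key_precedes (y z : int) : kept y -> kept z -> (y < 0) = (z < 0) ->
  (key y < key z)%N -> (`|z| <= 4 * `|y|)%N \/ stage y = stage z -> precedes y z.
Proof.
move=> ky kz s /key_cases[lt|[_ //]] H.
case: H => [le4|e]; last by lia.
have /andP[y0 _] : (y != 0) && ~~ (2 * m %| slot y)%N by [].
have /andP[_ hz] := stage_bounds kz; have /andP[hy _] := stage_bounds ky.
have := expo_le4 y0 le4.
have lt2 : ((stage y).+2 <= stage z)%N.
  have := stage_parity y; have := stage_parity z; rewrite s => <- e.
  rewrite ltn_neqAle lt andbT; apply: contra_eqN e => /eqP <-.
  by rewrite /=; case: odd.
by exists M; nia.
Qed.

(** * Excluding monotone progressions *)

Lemma no_key_ap3 (a b c : int) : kept a -> kept b -> kept c -> b - a = c - b ->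
  (a < 0) = (b < 0) -> (b < 0) = (c < 0) ->
  (key a < key b)%N -> (key b < key c)%N ->
  (`|b| <= 4 * `|a|)%N \/ stage a = stage b /\ stage b = stage c -> False.
Proof.
move=> ka kb kc abc ab bc lab lbc H.
apply: (precedes_ap abc ab bc).
  by apply: key_precedes => //; case: H => [|[]]; [left|right].
by apply: key_precedes => //; case: H => [|[]]; [left; lia|right].
Qed.

(* If [|z|] is at most four times [|w|], then [z] is at most two stages after
   [w]; being of the opposite sign, it lies in the very next stage. *)
Lemma stage_squeeze (w y z : int) : kept w -> kept y -> kept z ->
  (w < 0) = ~~ (z < 0) -> (y < 0) = (z < 0) -> (`|z| <= 4 * `|w|)%N ->
  (key w < key y)%N -> (stage y <= stage z)%N ->
  stage y = (stage w).+1 /\ stage z = (stage w).+1.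
Proof.
move=> kw ky kz wz yz le4 /key_cases lt le.
have /andP[w0 _] : (w != 0) && ~~ (2 * m %| slot w)%N by [].
have /andP[_ hz] := stage_bounds kz; have /andP[hw _] := stage_bounds kw.
have := expo_le4 w0 le4 => e; have := bitcode_lt M w; rewrite -/m => cw.
have lt3 : (stage z < (stage w).+3)%N by nia.
have := stage_parity w; have := stage_parity z; have := stage_parity y.
by rewrite wz yz; lia.
Qed.

Lemma key_le y z : (key y < key z)%N -> (stage y <= stage z)%N.
Proof. by move=> /key_cases[/ltnW|[-> _]]. Qed.

Lemma no_key_ap4 (x d : int) : d != 0 ->
  kept x -> kept (x + d) -> kept (x + 2 * d) -> kept (x + 3 * d) ->
  (key x < key (x + d)%R < key (x + 2 * d)%R)%N ->
  (key (x + 2 * d)%R < key (x + 3 * d)%R)%N -> False.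
Proof.
move=> d0; set b := x + d; set c := x + 2 * d; set e := x + 3 * d.
move=> kx kb kc ke /andP[lxb lbc] lce.
have e1 : b - x = c - b by rewrite /b /c; lia.
have e2 : c - b = e - c by rewrite /b /c /e; lia.
have nz y : kept y -> y != 0 by case/andP.
have := nz _ kx; have := nz _ kb; have := nz _ kc; have := nz _ ke => e0 c0 b0 x0.
have [s1|s1] := eqVneq (b < 0) (c < 0); have [s2|s2] := eqVneq (c < 0) (e < 0).
- have [le4|gt4] := leqP `|c| (4 * `|b|).
    by apply: (no_key_ap3 kb kc ke) => //; left.
  (* Growth by more than 4 puts [x] on the other side of 0 with [|e| <= 4 |x|], so [b], [c], [e] all
     lie in the stage right after that of [x]. *)
  have [sb sc] : stage b = (stage x).+1 /\ stage e = (stage x).+1.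
    apply: stage_squeeze => //; [lia|lia|lia|].
    exact: leq_trans (key_le lbc) (key_le lce).
  have := key_le lbc; have := key_le lce => ? ?.
  by apply: (no_key_ap3 kb kc ke) => //; right; lia.
(* Only [e] lies beyond 0, so [x], [b], [c] approach 0 and [|b| <= |x|]. *)
- by apply: (no_key_ap3 kx kb kc) => //; [lia|left; lia].
(* Now 0 separates [b] from [c]. The pair [x], [b] approaches 0; if [|e| > 4 |c|], then
   [|e| <= 4 |x|] forces [c] and [e] into one stage. *)
- have pxb : precedes x b by apply: key_precedes => //; [lia|left; lia].
  have pce : precedes c e.
    apply: key_precedes => //; have [le4|gt4] := leqP `|e| (4 * `|c|); [by left|right].
    have [-> -> //] : stage c = (stage x).+1 /\ stage e = (stage x).+1.
    apply: stage_squeeze => //; [lia|lia| |].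
      by have := key_cases lxb; have := key_cases lbc; lia.
    exact: key_le.
  by apply: (precedes_crossing e1 e2 _ _ _ pxb pce); lia.
- by lia.
Qed.

End Stages.

(** * Enumeration by increasing key *)

Lemma infinite_enumeration (X : Type) (T : set X) (f : X -> nat) :
  infinite_set T -> {in T &, injective f} ->
  exists p : nat -> X, set_bij [set: nat] T p /\
    {homo f \o p : i j / (i < j)%N}.
Proof.
move=> infT f_inj.
have unbounded n : exists k, `[< exists x, [/\ T x, f x = k & (n <= k)%N] >].
  apply: contrapT => H; apply: infT.
  rewrite -(eq_finite_set (inj_card_eq f_inj)).
  apply: sub_finite_set (finite_II n) => _ [x Tx <-] /=.
  rewrite ltnNge; apply/negP => nx; apply: H.
  by exists (f x); apply/asboolP; exists x.
have /choice[nxt nxtP] : forall n, exists x, [/\ T x, (n <= f x)%N &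
    forall y, T y -> (n <= f y)%N -> (f x <= f y)%N].
  move=> n; case: (ex_minnP (unbounded n)) => k /asboolP[x [Tx <- nx]] kmin.
  exists x; split=> // y Ty ny; apply: kmin; apply/asboolP.
  by exists y.
pose p := fix p n := if n is n'.+1 then nxt (f (p n')).+1 else nxt 0%N.
have Tp n : T (p n) by case: n => [|n]; [case: (nxtP 0%N)|case: (nxtP (f (p n)).+1)].
have p_lt : {homo f \o p : i j / (i < j)%N}.
  apply: homo_ltn; first exact: ltn_trans.
  by move=> i /=; case: (nxtP (f (p i)).+1).
exists p; split=> //; split=> [n _|i j _ _ e|x Tx]; first exact: Tp.
  by have [ij|ij|//] := ltngtP i j; have := p_lt _ _ ij; rewrite /= e; lia.
have large n : (n <= f (p n))%N.
  by elim: n => // n IH; apply: leq_ltn_trans IH _; apply: p_lt.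
(* The first [n] with [f x <= f (p n)] has [p n = x], since [x] was still available when [p n] was
   chosen with least value. *)
have ex : exists n, (f x <= f (p n))%N by exists (f x).
case: (ex_minnP ex) => n xn nmin; exists n => //.
apply: f_inj; [exact/mem_set/Tp|exact/mem_set|].
apply/eqP; rewrite eqn_leq xn andbT.
case: n xn nmin => [|n] _ nmin; first by case: (nxtP 0%N) => _ _; apply.
case: (nxtP (f (p n)).+1) => _ _; apply=> //.
by rewrite ltnNge; apply/negP => /nmin; rewrite ltnn.
Qed.

Lemma permutable_kept M l (T : set int) : (4 <= l)%N -> T `<=` kept M ->
  infinite_set T -> permutable l T.
Proof.
move=> hl TS infT.
have kT : {in T &, injective (key M)}.
  by move=> y z; rewrite !inE => /TS ky /TS kz; apply: key_inj.
have [p [bij_p lt_p]] := infinite_enumeration infT kT.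
exists p; split=> // -[i [x [d [i_lt d0 ip]]]].
have pk n : kept M (p n) by apply: TS; case: bij_p => fp _ _; apply: fp.
pose o k (hk : (k < 4)%N) : 'I_l := Ordinal (leq_trans hk hl).
have := ip (o 0%N isT); have := ip (o 1%N isT).
have := ip (o 2%N isT); have := ip (o 3%N isT).
rewrite /= mul0r addr0 mul1r => p3 p2 p1 p0.
have := lt_p _ _ (i_lt (o 0%N isT) (o 1%N isT) isT).
have := lt_p _ _ (i_lt (o 1%N isT) (o 2%N isT) isT).
have := lt_p _ _ (i_lt (o 2%N isT) (o 3%N isT) isT).
have := pk (i (o 0%N isT)); have := pk (i (o 1%N isT)).
have := pk (i (o 2%N isT)); have := pk (i (o 3%N isT)).
rewrite /= p0 p1 p2 p3 => k3 k2 k1 k0 lt23 lt12 lt01.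
by apply: (no_key_ap4 d0 k0 k1 k2 k3) => //; apply/andP.
Qed.

(** * Counting the kept numbers *)

Lemma finite_set_itvz (a b : int) : finite_set `[a, b].
Proof.
apply: (@sub_finite_set _ _ ((fun k : nat => a + k%:Z) @` `I_(`|b - a|.+1))).
  move=> x /=; rewrite in_itv /= => /andP[ax xb].
  by exists `|x - a|%N => /=; lia.
exact/finite_image/finite_II.
Qed.

Lemma count_in_ge (S : set int) (a b : int) (s : seq int) : uniq s ->
  (forall y, y \in s -> S y /\ a <= y <= b) -> (size s <= count_in S a b)%N.
Proof.
move=> us sS; apply: uniq_leq_size => // y ys.
rewrite in_fset_set; last by apply: finite_setIr; apply: finite_set_itvz.
by rewrite inE /= in_itv /=; apply: sS.
Qed.

Lemma count_in_le (S : set int) (a b : int) : a <= b + 1 ->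
  (count_in S a b <= `|(b + 1 - a)%R|)%N.
Proof.
move=> ab; rewrite -(size_iota 0 `|(b + 1 - a)%R|).
rewrite -(size_map (fun k : nat => a + k%:Z)).
apply: uniq_leq_size; first exact: fset_uniq.
move=> y; rewrite in_fset_set; last by apply: finite_setIr; apply: finite_set_itvz.
rewrite inE /= in_itv /= => -[_ /andP[ay yb]].
by apply/mapP; exists `|y - a|%N; rewrite ?mem_iota; lia.
Qed.

Definition with_sign (neg : bool) (k : nat) : int := if neg then - k%:Z else k%:Z.

Lemma with_sign_lt0 neg k : (0 < k)%N -> (with_sign neg k < 0) = neg.
Proof. by rewrite /with_sign; case: neg; lia. Qed.

Lemma absz_with_sign neg k : `|with_sign neg k|%N = k.
Proof. by rewrite /with_sign; case: neg; lia. Qed.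

Lemma with_sign_neq0 neg k : (0 < k)%N -> with_sign neg k != 0.
Proof. by rewrite /with_sign; case: neg; lia. Qed.

Section Counting.
Variable M : nat.
Let m := (2 ^ M)%N.
Let m_gt0 : (0 < m)%N. Proof. by rewrite expn_gt0. Qed.

(* Within one power of 4 the removed numbers of a given sign form a single
   residue class modulo [m], hence [k %/ m + trunc_log 4 k] separates them. *)
Lemma count_removed neg n :
  (count (fun k => 2 * m %| slot M (with_sign neg k)) (iota 1 n)
    <= n %/ m + (trunc_log 4 n).+1)%N.
Proof.
rewrite -size_filter; set s := seq.filter _ _.
rewrite addnS -(size_iota 0 (n %/ m + trunc_log 4 n).+1).
rewrite -(size_map (fun k => k %/ m + trunc_log 4 k)%N).
have sP k : k \in s -> [/\ (0 < k)%N, (k <= n)%N & (2 * m %| slot M (with_sign neg k))%N].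
  by rewrite mem_filter mem_iota => /andP[? ?]; split=> //; lia.
have us : uniq s by rewrite filter_uniq ?iota_uniq.
clearbody s; apply: uniq_leq_size; last first.
  move=> _ /mapP[k /sP[k0 kn _] ->]; rewrite mem_iota /= add0n ltnS.
  by apply: leq_add; [exact: leq_div2r|exact: leq_trunc_log].
rewrite map_inj_in_uniq // => k l /sP[k0 _ dk] /sP[l0 _ dl].
wlog kl : k l k0 l0 dk dl / (k <= l)%N.
  by move=> H e; have [kl|/ltnW kl] := leqP k l; [|symmetry]; apply: H.
move=> e.
have ek : (k %/ m = l %/ m)%N /\ trunc_log 4 k = trunc_log 4 l.
  by have := leq_div2r m kl; have := leq_trunc_log 4 kl; lia.
case: ek e => eq_div eq_log _.
(* Both slots vanish modulo [2 * m] and the exponents agree, while [neg * m + bitcode] is below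
   [2 * m]. *)
have : bitcode M (with_sign neg k) = bitcode M (with_sign neg l).
  move: (bitcode_lt M (with_sign neg k)) (bitcode_lt M (with_sign neg l)) dk dl.
  rewrite /slot /expo !absz_with_sign eq_log !with_sign_lt0 // -/m.
  move: (bitcode _ _) (bitcode _ _) => v u um vm /dvdnP[a ha] /dvdnP[b hb].
  have um2 : (neg * m + u < 2 * m)%N by clear sP ha hb; case: neg => /=; lia.
  have vm2 : (neg * m + v < 2 * m)%N by clear sP ha hb um2; case: neg => /=; lia.
  have : (neg * m + u = neg * m + v)%N.
    rewrite -(modn_small um2) -(modn_small vm2).
    rewrite -(modnMDl a (neg * m + u)) -(modnMDl b (neg * m + v)).
    by congr (_ %% _)%N; lia.
  by lia.
rewrite /bitcode /fold0 !with_sign_lt0 // => /bitrev_eqmod[q]; rewrite -/m => hq.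
have [q' hq'] : exists q' : int, l%:Z - k%:Z = q' * m%:Z.
  by exists (- q); clear sP dk dl; move: hq; rewrite /with_sign; case: neg; lia.
have lt : (l < k + m)%N.
  have := divn_eq k m; have := divn_eq l m; rewrite eq_div.
  by have := ltn_pmod l m_gt0; lia.
have q0 : q' = 0 by nia.
by move: hq'; rewrite q0; lia.
Qed.

(** The logarithmic term [e.+1] of [count_removed] is also at most [n / m], because [m] and [e.+1]
    both have square at most [n]. *)
Lemma count_kept neg n : (m ^ 2 <= n)%N ->
  (m * n <= m * count (fun k => with_sign neg k \in kept M) (iota 1 n) + 2 * n)%N.
Proof.
move=> mn; have n0 : (0 < n)%N by apply: leq_trans mn; rewrite expn_gt0 m_gt0.
have := count_predC (fun k => 2 * m %| slot M (with_sign neg k))%N (iota 1 n).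
rewrite size_iota; set r := count _ _; set c := count _ _ => rc.
have -> : count (fun k => with_sign neg k \in kept M) (iota 1 n) = c.
  apply: eq_in_count => k; rewrite mem_iota => /andP[k0 _] /=.
  by apply/idP/idP; rewrite inE /kept /= with_sign_neq0.
have rle : (r <= n %/ m + (trunc_log 4 n).+1)%N := count_removed neg n.
have /andP[ln _] := trunc_log_bounds (isT : 1 < 4)%N n0.
have le2 : ((trunc_log 4 n).+1 <= 2 ^ trunc_log 4 n)%N by apply: ltn_expl.
have le4 : ((trunc_log 4 n).+1 ^ 2 <= 4 ^ trunc_log 4 n)%N.
  by rewrite -[4%N]/(2 ^ 2)%N expnAC leq_exp2r.
have dm := leq_divM n m.
move: (trunc_log 4 n) (n %/ m)%N le2 le4 ln rle dm mn => e d _ le4 ln rle dm mn.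
rewrite -!mulnn in le4 mn.
have : (m * e.+1 <= n)%N by have [|] := leqP e.+1 m; nia.
by nia.
Qed.

Lemma count_in_kept_pos n : (m ^ 2 <= n)%N ->
  (m * n <= m * count_in (kept M `&` posint) 1 n%:Z + 2 * n)%N.
Proof.
move=> /(count_kept false) h; apply: leq_trans h _.
rewrite leq_add2r leq_mul2l; apply/orP; right.
rewrite -size_filter -(size_map (with_sign false)); apply: count_in_ge.
  by rewrite map_inj_uniq ?filter_uniq ?iota_uniq // => k l [].
move=> y /mapP[k]; rewrite mem_filter mem_iota => /andP[kk kn] ->.
by move: kk; rewrite inE => kk; split; [split|]; rewrite // /posint /with_sign /=; lia.
Qed.

Lemma count_in_kept n : (m ^ 2 <= n)%N ->
  (m * (2 * n) <= m * count_in (kept M) (- n%:Z) n%:Z + 4 * n)%N.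
Proof.
move=> mn; have := count_kept false mn; have := count_kept true mn.
set c1 := count _ _; set c0 := count _ _ => h1 h0.
suff : (c0 + c1 <= count_in (kept M) (- n%:Z) n%:Z)%N by nia.
rewrite /c0 /c1 -!size_filter -(size_map (with_sign false)) -(size_map (with_sign true)).
rewrite -size_cat; apply: count_in_ge.
  rewrite cat_uniq !map_inj_uniq ?filter_uniq ?iota_uniq //=; last 2 first.
  - by move=> k l; rewrite /with_sign; lia.
  - by move=> k l; rewrite /with_sign; lia.
  rewrite andbT; apply/hasPn => _ /mapP[k hk ->].
  apply/mapP => -[l hl]; move: hk hl; rewrite !mem_filter !mem_iota /with_sign.
  by lia.
move=> y; rewrite mem_cat => /orP[] /mapP[k];
  rewrite mem_filter mem_iota => /andP[kk kn] ->;
  by move: kk; rewrite inE => kk; split; rewrite // /with_sign /=; lia.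
Qed.

End Counting.

(** The modulus is at least 4, so at least half of [[1, n]] is kept for large [n]. *)
Lemma infinite_kept_pos M : infinite_set (kept M.+2 `&` posint).
Proof.
move=> fin; set c := #|` fset_set (kept M.+2 `&` posint)|.
have le n : (count_in (kept M.+2 `&` posint) 1 n%:Z <= c)%N.
  apply: fsubset_leq_card; rewrite -fset_set_sub; [exact: subIsetl|exact: finite_setIl|by []].
pose n := ((2 ^ M.+2) ^ 2 + 2 * c + 1)%N.
have := @count_in_kept_pos M.+2 n (ltac:(rewrite /n; lia)); have := le n.
have : (4 <= 2 ^ M.+2)%N by rewrite -[4%N]/(2 ^ 2)%N leq_exp2l.
move: (count_in _ _ _); rewrite /n; move: (2 ^ M.+2)%N => m k; nia.
Qed.

(** * Densities and suprema *)

Lemma limn_inf_sup_bounds (R : realType) (u : R^nat) (c : R) (N : nat) :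
  (forall n, 0 <= u n <= 1) -> (forall n, (N <= n)%N -> c <= u n) ->
  (c <= limn_inf u <= 1) /\ (c <= limn_sup u <= 1).
Proof.
move=> u01 cu.
have u_le1 n : u n <= 1 by case/andP: (u01 n).
have u_ge0 n : 0 <= u n by case/andP: (u01 n).
have bu : bounded_fun u.
  exists 1; split=> // r r1 n _ /=; rewrite ger0_norm //.
  exact: le_trans (u_le1 n) (ltW r1).
have ubd n : has_ubound (sdrop u n) by exists 1 => _ [k _ <-].
have lbd n : has_lbound (sdrop u n) by exists 0 => _ [k _ <-].
have in_drop n k : (n <= k)%N -> sdrop u n (u k) by exists k.
have sups_ge n : c <= sups u n.
  apply: le_trans (cu _ (leq_maxr n N)) _.
  by apply: ub_le_sup => //; apply: in_drop; apply: leq_maxl.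
have sups_le n : sups u n <= 1.
  by apply: ge_sup; [exists (u n); apply: in_drop|move=> _ [k _ <-]].
have infs_le n : infs u n <= 1.
  by apply: le_trans (u_le1 n); apply: ge_inf => //; apply: in_drop.
have infs_ge : c <= infs u N.
  by apply: lb_le_inf; [exists (u N); apply: in_drop|move=> _ [k /= Nk <-]; apply: cu].
rewrite (limn_supE bu) (limn_infE bu); split; apply/andP; split.
- apply: le_trans infs_ge _; apply: ub_le_sup; last by exists N.
  by exists 1 => _ [n _ <-].
- by apply: ge_sup; [exists (infs u 0%N), 0%N|move=> _ [n _ <-]].
- by apply: lb_le_inf; [exists (sups u 0%N), 0%N|move=> _ [n _ <-]].
- apply: le_trans (sups_le 0%N); apply: ge_inf; last by exists 0%N.
  by exists c => _ [n _ <-].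
Qed.

Lemma sup_eq1 (R : realType) (A : set R) : (forall x, A x -> x <= 1) ->
  (forall M : nat, exists2 x, A x & 1 - 3 / (2 ^ M.+2)%N%:R <= x) -> sup A = 1.
Proof.
move=> A1 Alarge; have [x0 Ax0 _] := Alarge 0%N.
apply/eqP; rewrite eq_le ge_sup //=; last by exists x0.
rewrite leNgt; apply/negP => sup1.
pose M := Num.bound (3 / (1 - sup A)).
have [x Ax] := Alarge M; apply/negP; rewrite -ltNge.
have : x <= sup A by apply: ub_le_sup => //; exists 1.
move=> /le_lt_trans; apply; rewrite ltrBrDr -ltrBrDl.
rewrite ltr_pdivrMr ?ltr0n ?expn_gt0 // mulrC -ltr_pdivrMr ?subr_gt0 //.
apply: lt_trans (archi_boundP _) _; first by rewrite divr_ge0 // subr_ge0 ltW.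
by rewrite ltr_nat -/M; apply: leq_trans (ltn_expl M (isT : 1 < 2)%N) _; rewrite leq_exp2l; lia.
Qed.

Lemma ratio_bounds (R : realType) (m c q : nat) : (0 < m)%N -> (0 < q)%N ->
  (m * q <= m * c + 3 * q)%N -> 1 - 3 / m%:R <= c%:R / q%:R :> R.
Proof.
move=> m0 q0 h; rewrite ler_pdivlMr ?ltr0n // mulrBl mul1r lerBlDr.
rewrite -(ler_pM2l (_ : 0 < m%:R)) ?ltr0n // mulrDr.
have -> : m%:R * (3 / m%:R * q%:R) = 3 * q%:R :> R.
  by rewrite mulrA mulrCA divff ?mulr1 // pnatr_eq0 -lt0n.
by rewrite -!natrM -natrD ler_nat.
Qed.

Lemma ratio_01 (R : realType) (c q : nat) : (c <= q)%N ->
  0 <= (c%:R : R) / q%:R <= 1.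
Proof.
move=> cq; rewrite divr_ge0 ?ler0n //=.
have [->|q0] := posnP q; first by rewrite invr0 mulr0 ler01.
by rewrite ler_pdivrMr ?ltr0n // mul1r ler_nat.
Qed.

Lemma densityN_bounds (R : realType) (S : set int) (c : R) (N : nat) :
  (forall n, (N <= n)%N -> c <= ratioN R S n) ->
  (c <= lower_densityN R S <= 1) /\ (c <= upper_densityN R S <= 1).
Proof.
apply: limn_inf_sup_bounds => n; apply: ratio_01.
by apply: leq_trans (count_in_le _ _) _; lia.
Qed.

Lemma densityZ_bounds (R : realType) (S : set int) (c : R) (N : nat) :
  (forall n, (N <= n)%N -> c <= ratioZ R S n) ->
  (c <= lower_densityZ R S <= 1) /\ (c <= upper_densityZ R S <= 1).
Proof.
apply: limn_inf_sup_bounds => n; apply: ratio_01.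
by apply: leq_trans (count_in_le _ _) _; lia.
Qed.

Lemma ratioN_kept (R : realType) M n : ((2 ^ M) ^ 2 <= n)%N ->
  1 - 3 / (2 ^ M)%N%:R <= ratioN R (kept M `&` posint) n.
Proof.
move=> mn; apply: ratio_bounds; first by rewrite expn_gt0.
  by apply: leq_trans mn; rewrite !expn_gt0.
by apply: leq_trans (count_in_kept_pos mn) _; lia.
Qed.

Lemma ratioZ_kept (R : realType) M n : ((2 ^ M) ^ 2 <= n)%N ->
  1 - 3 / (2 ^ M)%N%:R <= ratioZ R (kept M) n.
Proof.
move=> mn; apply: ratio_bounds; [by rewrite expn_gt0|by lia|].
(* The 1 in the denominator [2 * n + 1] costs an extra [2 ^ M <= n], which the constant 3
   absorbs. *)
have := count_in_kept mn; have : (2 ^ M <= n)%N.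
  by apply: leq_trans mn; rewrite -[leqLHS]expn1 leq_pexp2l // expn_gt0.
by lia.
Qed.

Theorem corollary1p3 (R : realType) (l : nat) (hl : (4 <= l)%N) :
  [/\ alphaN R l = 1, betaN R l = 1, alphaZ R l = 1 & betaZ R l = 1].
Proof.
have subN M : permutable_subsets posint l (kept M.+2 `&` posint).
  split; [by move=> x []|exact: infinite_kept_pos|].
  by apply: (permutable_kept hl (@subIsetl _ _ _)); apply: infinite_kept_pos.
have infZ M : infinite_set (kept M.+2).
  by apply: sub_infinite_set (@infinite_kept_pos M) => x [].
have subZ M : permutable_subsets [set: int] l (kept M.+2).
  by split=> //; apply: (@permutable_kept M.+2).
have N01 S : (0 <= lower_densityN R S <= 1) /\ (0 <= upper_densityN R S <= 1).
  apply: (@densityN_bounds _ _ _ 0%N) => n _.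
  by rewrite divr_ge0 ?ler0n.
have Z01 S : (0 <= lower_densityZ R S <= 1) /\ (0 <= upper_densityZ R S <= 1).
  apply: (@densityZ_bounds _ _ _ 0%N) => n _.
  by rewrite divr_ge0 ?ler0n.
have keptN M := @densityN_bounds R _ _ _ (@ratioN_kept R M.+2).
have keptZ M := @densityZ_bounds R _ _ _ (@ratioZ_kept R M.+2).
split; apply: sup_eq1.
- by move=> _ [S _ <-]; case: (N01 S) => _ /andP[].
- move=> M; have [_ /andP[ge _]] := keptN M.
  by exists (upper_densityN R (kept M.+2 `&` posint)) => //; exists (kept M.+2 `&` posint).
- by move=> _ [S _ <-]; case: (N01 S) => /andP[].
- move=> M; have [/andP[ge _] _] := keptN M.
  by exists (lower_densityN R (kept M.+2 `&` posint)) => //; exists (kept M.+2 `&` posint).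
- by move=> _ [S _ <-]; case: (Z01 S) => _ /andP[].
- move=> M; have [_ /andP[ge _]] := keptZ M.
  by exists (upper_densityZ R (kept M.+2)) => //; exists (kept M.+2).
- by move=> _ [S _ <-]; case: (Z01 S) => /andP[].
- move=> M; have [/andP[ge _] _] := keptZ M.
  by exists (lower_densityZ R (kept M.+2)) => //; exists (kept M.+2).
Qed.
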